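(* Let $P \subset \mathbb{R}^d$ be a reflexive polytope of dimension $d$, and let $\operatorname{bipyr}(P) \subset \mathbb{R}^{d+1}$ be its bipyramid. Then the following conditions are equivalent: (i) $P$ is normal; (ii) $\operatorname{bipyr}(P)$ is normal; (iii) $\operatorname{bipyr}(P)$ is very ample.
   Context: A lattice polytope is a convex polytope $P \subset \mathbb{R}^d$ each of whose vertices belongs to $\mathbb{Z}^d$. A lattice polytope $P \subset \mathbb{R}^d$ of dimension $d$ is reflexive if the origin of $\mathbb{R}^d$ belongs to the interior of $P$ and the dual polytope $P^\vee = \{\mathbf{x} \in \mathbb{R}^d : \langle \mathbf{x}, \mathbf{y}\rangle \leq 1 \text{ for all } \mathbf{y} \in P\}$ is a lattice polytope, where $\langle\cdot,\cdot\rangle$ is the canonical inner product. The bipyramid $\operatorname{bipyr}(P) \subset \mathbb{R}^{d+1}$ of a convex polytope $P \subset \mathbb{R}^d$ is the convex hull of $\{(\mathbf{a},0) \in \mathbb{R}^{d+1} : \mathbf{a} \in P\} \cup \{(0,\ldots,0,1), (0,\ldots,0,-1)\}$. For an integer $N \geq 1$ put $NP = \{N\mathbf{a} : \mathbf{a} \in P\}$. A lattice polytope $P \subset \mathbb{R}^d$ is normal if for each integer $N \geq 1$ and each $\mathbf{a} \in NP \cap \mathbb{Z}^d$ there exist $\mathbf{a}_1, \ldots, \mathbf{a}_N \in P \cap \mathbb{Z}^d$ with $\mathbf{a} = \mathbf{a}_1 + \cdots + \mathbf{a}_N$. It is very ample if the same holds for all sufficiently large $N$, i.e. there is $N_0$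 such that for each $N \geq N_0$ and each $\mathbf{a} \in NP \cap \mathbb{Z}^d$ there exist $\mathbf{a}_1, \ldots, \mathbf{a}_N \in P \cap \mathbb{Z}^d$ with $\mathbf{a} = \mathbf{a}_1 + \cdots + \mathbf{a}_N$. *)

(* Defs.v *)
From HB Require Import structures.
From mathcomp Require Import all_boot all_order all_algebra.
From mathcomp Require Import boolp classical_sets functions cardinality reals.
From mathcomp Require Import topology normedtype convex.

Set Implicit Arguments.
Unset Strict Implicit.
Unset Printing Implicit Defensive.

Import Order.TTheory GRing.Theory Num.Theory.
Import numFieldNormedType.Exports.

Local Open Scope classical_set_scope.
Local Open Scope ring_scope.

Section LatticePolytopes.
Context {R : realType} {d : nat}.
Implicit Types (P A : set 'rV[R]_d) (v x y : 'rV[R]_d).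

Definition dotv x y : R := \sum_(i < d) x 0 i * y 0 i.

Definition lattice_pt x := x \is a mxOver Num.int.

Definition conv_hull A : set 'rV[R]_d := smallest (@convex_set R _) A.

Definition polytope P := exists A, finite_set A /\ P = conv_hull A.

(* Vertices of a polytope are its extreme points. *)
Definition vertex P v :=
  P v /\ forall x y (t : R), P x -> P y -> 0 < t < 1 ->
           v = t *: x + (1 - t) *: y -> x = v /\ y = v.

Definition lattice_polytope P :=
  polytope P /\ forall v, vertex P v -> lattice_pt v.

(* [k] is the dimension of the affine span of [P]: the rows of [M] are a basis
   of the direction space of that span, each of them joining [x] to a point
   of [P]. *)
Definition has_dim (k : nat) P :=
  exists x (M : 'M[R]_(k, d)),
    [/\ P x, row_free M, forall i, P (x + row i M)
      & forall y, P y -> (y - x <= M)%MS].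

Definition dual_polytope P : set 'rV[R]_d :=
  [set x | forall y, P y -> dotv x y <= 1].

Definition reflexive_polytope P :=
  [/\ lattice_polytope P, has_dim d P, interior P 0
    & lattice_polytope (dual_polytope P)].

Definition dilate (N : nat) P : set 'rV[R]_d := [set N%:R *: a | a in P].

Definition decomposable_at P (N : nat) :=
  forall a, dilate N P a -> lattice_pt a ->
    exists f : 'I_N -> 'rV[R]_d,
      (forall i, P (f i) /\ lattice_pt (f i)) /\ a = \sum_(i < N) f i.

Definition normal_polytope P :=
  lattice_polytope P /\ forall N, (1 <= N)%N -> decomposable_at P N.

Definition very_ample P :=
  lattice_polytope P /\
  exists N0, forall N, (N0 <= N)%N -> decomposable_at P N.

End LatticePolytopes.

Definition bipyr (R : realType) (d : nat) (P : set 'rV[R]_d) :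
    set 'rV[R]_(d + 1) :=
  conv_hull ([set row_mx a 0 | a in P]
             `|` [set row_mx 0 1%:M; row_mx 0 (- 1%:M)]).

(* Main.v *)
(** Since [P] contains the origin, [bipyr P] is the set of all [(alpha p, t)]
    with [p] in [P], [0 <= alpha] and [alpha + |t| <= 1], so its lattice points
    are those of [P] at height 0 and the two apexes. A lattice point [(x, n)] of
    [N bipyr(P)] satisfies [x \in (N - |n|) P]; splitting off [|n|] copies of an
    apex shows that [bipyr P] is normal when [P] is. Conversely, a lattice point
    [x] of [N P] gives the lattice point [(x, M - N)] of [M bipyr(P)] for every
    [M >= N]. If the latter is a sum of [M] lattice points, [k] of them at
    height 0 and [q] of them equal to the lower apex, comparing heights yields
    [k + 2 q = N], so [x] is a sum of [k] lattice points of [P] and of [2 q]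
    zeros. *)
Require Import Defs.
From mathcomp Require Import all_boot all_order all_algebra.
From mathcomp Require Import classical_sets reals.
From mathcomp Require Import interval_inference cardinality.
From mathcomp Require Import topology normedtype convex zify ring lra.

Set Implicit Arguments.
Unset Strict Implicit.
Unset Printing Implicit Defensive.

Import Order.TTheory GRing.Theory Num.Theory.

Local Open Scope classical_set_scope.
Local Open Scope ring_scope.

(** * Convex combinations with unnormalised weights *)

Section Convexity.
Context {R : realType} {d : nat}.
Implicit Types (P A : set 'rV[R]_d) (x y p q : 'rV[R]_d).

Lemma convex_setE A : @convex_set R _ A <->
  forall x y (t : R), 0 <= t <= 1 -> A x -> A y -> A (t *: x + (1 - t) *: y).
Proof.
split=> [cA x y t /andP[t0 t1] Ax Ay|cA x y t].
  by have := cA x y (Itv01 t0 t1); rewrite !inE; apply.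
by rewrite !inE; apply: cA; rewrite ge0 le1.
Qed.

Lemma convex_conv_hull A : @convex_set R _ (conv_hull A).
Proof.
apply/convex_setE => x y t t01 Ax Ay C CC.
by have /convex_setE cC := CC.1; apply: cC => //; [exact: Ax|exact: Ay].
Qed.

Lemma convex_comb P p q (a b : R) : @convex_set R _ P -> P p -> P q ->
  0 <= a -> 0 <= b -> exists2 r, P r & a *: p + b *: q = (a + b) *: r.
Proof.
move=> /convex_setE cP Pp Pq a0 b0.
have [ab0|ab0] := eqVneq (a + b) 0.
  have -> : a = 0 by lra.
  have -> : b = 0 by lra.
  by exists p => //; rewrite addr0 !scale0r addr0.
exists ((a / (a + b)) *: p + (1 - a / (a + b)) *: q).
  by apply: cP => //; rewrite divr_ge0 ?ler_pdivrMr ?mul1r /=; lra.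
by rewrite scalerDr !scalerA; congr (_ *: _ + _ *: _); field.
Qed.

(** The missing weight [b - a] is put on the origin. *)
Lemma convex_scale P p (a b : R) : @convex_set R _ P -> P 0 -> P p ->
  0 <= a -> a <= b -> exists2 q, P q & a *: p = b *: q.
Proof.
move=> cP P0 Pp a0 ab.
have [|r Pr] := convex_comb cP Pp P0 a0 (_ : 0 <= b - a); first by lra.
by rewrite scaler0 addr0 subrKC => ->; exists r.
Qed.

End Convexity.

(** * Sums of lattice points of a set *)

Section LatticeSums.
Context {R : realType} {d : nat}.
Implicit Types (P : set 'rV[R]_d) (a b c : 'rV[R]_d).

(** The conclusion of [decomposable_at], isolated so that summands can be added and removed one at a
    time. *)
Definition lattice_sum P N a :=
  exists f : 'I_N -> 'rV[R]_d,
    (forall i, P (f i) /\ lattice_pt (f i)) /\ a = \sum_(i < N) f i.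

Lemma lattice_sum0 P : lattice_sum P 0 0.
Proof. by exists (fun=> 0); split=> [[]//|]; rewrite big_ord0. Qed.

Lemma lattice_sumS P N c a : P c -> lattice_pt c -> lattice_sum P N a ->
  lattice_sum P N.+1 (c + a).
Proof.
move=> Pc Lc [f [fP ->]].
exists (fun i => if unlift ord0 i is Some j then f j else c); split=> [i|].
  by case: unliftP.
rewrite big_ord_recl unlift_none; congr (_ + _).
by apply: eq_bigr => i _; rewrite liftK.
Qed.

Lemma lattice_sumS_inv P N a : lattice_sum P N.+1 a ->
  exists c b, [/\ P c, lattice_pt c, lattice_sum P N b & a = c + b].
Proof.
move=> [f [fP ->]]; exists (f ord0), (\sum_(i < N) f (lift ord0 i)).
have [P0 L0] := fP ord0; split=> //; last exact: big_ord_recl.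
by exists (fun i => f (lift ord0 i)).
Qed.

Lemma lattice_sum_padding P N c k a : P c -> lattice_pt c ->
  lattice_sum P N a -> lattice_sum P (k + N) (c *+ k + a).
Proof.
move=> Pc Lc Sa; elim: k => [|k IHk]; first by rewrite mulr0n add0r.
by rewrite mulrS -addrA addSn; apply: lattice_sumS.
Qed.

End LatticeSums.

(** * The bipyramid in coordinates (base point, height) *)

Section Bipyramid.
Context {R : realType} {d : nat}.
Variable P : set 'rV[R]_d.
Hypotheses (cP : @convex_set R _ P) (P0 : P 0).
Implicit Types (a p : 'rV[R]_d) (t : R) (v : 'rV[R]_(d + 1)).

Lemma height_split v : exists a t, v = row_mx a t%:M.
Proof.
by exists (lsubmx v), (rsubmx v 0 0); rewrite -mx11_scalar hsubmxK.
Qed.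

Lemma height_inj a b (s t : R) :
  row_mx a s%:M = row_mx b t%:M :> 'rV_(d + 1) -> a = b /\ s = t.
Proof.
move=> /eq_row_mx [-> /matrixP/(_ 0 0)].
by rewrite !mxE !mulr1n.
Qed.

Lemma height_add a b (s t : R) : row_mx a s%:M + row_mx b t%:M =
  row_mx (a + b) (s + t)%:M :> 'rV_(d + 1).
Proof. by rewrite add_row_mx raddfD. Qed.

Lemma height_scale k a t :
  k *: row_mx a t%:M = row_mx (k *: a) (k * t)%:M :> 'rV_(d + 1).
Proof. by rewrite scale_row_mx scale_scalar_mx. Qed.

Lemma lattice_pt_row_mx a t :
  lattice_pt (row_mx a t%:M : 'rV_(d + 1)) <->
  lattice_pt a /\ t \is a Num.int.
Proof.
split=> [/mxOverP L|[/mxOverP La Lt]].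
  split; last by have := L 0 (rshift d 0); rewrite row_mxEr mxE mulr1n.
  by apply/mxOverP => i j; have := L i (lshift 1 j); rewrite row_mxEl.
apply/mxOverP => i j; rewrite mxE; case: splitP => k _; first exact: La.
by rewrite !ord1 mxE mulr1n.
Qed.

(** From left to right, the set of such points contains the generators and is convex. Since the
    absolute value is only subadditive, convex combinations preserve the inequality on [alpha], not
    an equality. *)
Lemma bipyrP a t : bipyr P (row_mx a t%:M) <->
  exists p (alpha : R), [/\ P p, 0 <= alpha, alpha + `|t| <= 1 & a = alpha *: p].
Proof.
split=> [Bv|[p [alpha [Pp alpha0 alphat ->]]]].
  pose B := [set v | exists p (alpha s : R), [/\ P p, 0 <= alpha,
    alpha + `|s| <= 1 & v = row_mx (alpha *: p) s%:M]].
  suff /(_ _ Bv) [p [alpha [s [Pp alpha0 alphas]]]] : bipyr P `<=` B.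
    by move=> /height_inj[-> ->]; exists p, alpha.
  apply: smallest_sub.
    apply/convex_setE => x y l /andP[l0 l1].
    move=> [p [a1 [s1 [Pp a10 as1 ->]]]] [q [a2 [s2 [Pq a20 as2 ->]]]].
    have l10 : 0 <= 1 - l by lra.
    have [r Pr e] := convex_comb cP Pp Pq (mulr_ge0 l0 a10) (mulr_ge0 l10 a20).
    exists r, (l * a1 + (1 - l) * a2), (l * s1 + (1 - l) * s2); split=> //.
    - by rewrite addr_ge0 ?mulr_ge0.
    - have := ler_normD (l * s1) ((1 - l) * s2).
      rewrite !normrM (ger0_norm l0) (ger0_norm l10); nra.
    - by rewrite !height_scale height_add !scalerA e.
  move=> v [[p Pp <-]|[->|->]].
  - by exists p, 1, 0; rewrite normr0 addr0 scale1r raddf0.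
  - by exists 0, 0, 1; rewrite normr1 add0r scaler0.
  - by exists 0, 0, (- 1); rewrite normrN normr1 add0r scaler0 raddfN.
have /convex_setE cB : @convex_set R _ (bipyr P) := @convex_conv_hull _ _ _.
have Bbase q : P q -> bipyr P (row_mx q 0%:M).
  by move=> Pq; apply: sub_gen_smallest; left; exists q; rewrite // raddf0.
have Bapex (s : R) : -1 <= s <= 1 -> bipyr P (row_mx 0 s%:M).
  move=> s1.
  have -> : row_mx 0 s%:M = ((1 + s) / 2) *: row_mx 0 1%:M +
      (1 - (1 + s) / 2) *: row_mx 0 (- 1)%:M :> 'rV[R]_(d + 1).
    rewrite !height_scale !scaler0 height_add addr0; congr (row_mx _ _%:M).
    by field.
  apply: cB; first by lra.
    by apply: sub_gen_smallest; right; left.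
  by apply: sub_gen_smallest; right; right; rewrite raddfN.
(* The point [(alpha p, t)] lies on the segment joining [(q, 0)] to
   [(0, sg t)], where [alpha p = (1 - |t|) q]. *)
have [|q Pq ->] := convex_scale cP P0 Pp alpha0 (_ : alpha <= 1 - `|t|).
  by lra.
have -> : row_mx ((1 - `|t|) *: q) t%:M = `|t| *: row_mx 0 (Num.sg t)%:M +
    (1 - `|t|) *: row_mx q 0%:M :> 'rV[R]_(d + 1).
  by rewrite !height_scale height_add scaler0 add0r mulr0 addr0 [`|_| * _]mulrC -numEsg.
apply: cB; first by rewrite normr_ge0 /=; lra.
- by apply: Bapex; rewrite -ler_norml normr_sg lern1 leq_b1.
- exact: Bbase.
Qed.

Lemma bipyr_base p : P p -> bipyr P (row_mx p 0%:M).
Proof.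
by move=> Pp; apply/bipyrP; exists p, 1; rewrite normr0 addr0 scale1r.
Qed.

Lemma bipyr_apex t : `|t| <= 1 -> bipyr P (row_mx 0 t%:M).
Proof. by move=> t1; apply/bipyrP; exists 0, 0; rewrite add0r scaler0. Qed.

(** * Generators, vertices and lattice points of the bipyramid *)

Lemma bipyr_polytope : polytope P -> polytope (bipyr P).
Proof.
move=> [A [finA PA]].
pose E := [set row_mx 0 1%:M; row_mx 0 (- 1%:M)] : set 'rV[R]_(d + 1).
exists ([set row_mx a 0 | a in A] `|` E); split.
  by rewrite finite_setU; split; [exact: finite_image|exact: finite_set2].
rewrite /bipyr -/E; apply/seteqP; split; apply: smallest_sub.
- exact: convex_conv_hull.
- move=> v [[p Pp <-]|Ev]; last by apply: sub_gen_smallest; right.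
  rewrite PA in Pp.
  (* A hull is a smallest convex set, so [Pp] is applied to the preimage of the new hull under the
     embedding at height 0. *)
  apply: (Pp [set q | conv_hull ([set row_mx a 0 | a in A] `|` E)
                        (row_mx q 0)]).
  split=> [|a Aa]; last by apply: sub_gen_smallest; left; exists a.
  apply/convex_setE => x y t t01 /= Bx By.
  have -> : row_mx (t *: x + (1 - t) *: y) 0 =
      t *: row_mx x 0 + (1 - t) *: row_mx y 0 :> 'rV[R]_(d + 1).
    by rewrite !scale_row_mx add_row_mx !scaler0 addr0.
  by have /convex_setE := @convex_conv_hull _ _
     ([set row_mx a 0 | a in A] `|` E); apply.
- exact: convex_conv_hull.
- move=> v [[a Aa <-]|Ev]; apply: sub_gen_smallest; last by right.
  by left; exists a => //; rewrite PA; apply: sub_gen_smallest.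
Qed.

(** A point at height [t] lies on a segment from some [(q, 0)] to [(0, sg t)], with weight [|t|] on
    the latter. Extremality rules out [0 < |t| < 1], and at height 0 it passes to [q] in [P]. *)
Lemma bipyr_vertex v : vertex (bipyr P) v ->
  (exists2 p, vertex P p & v = row_mx p 0%:M) \/
  (exists2 t, `|t| = 1 & v = row_mx 0 t%:M).
Proof.
have [a [t ->]] := height_split v.
move=> [/bipyrP[p [alpha [Pp alpha0 alphat ->]]] V].
have [|q Pq e] := convex_scale cP P0 Pp alpha0 (_ : alpha <= 1 - `|t|).
  by lra.
rewrite {}e in V *.
have [t0|t0] := eqVneq t 0.
  left; exists q; last by rewrite t0 normr0 subr0 scale1r.
  split=> // x y s Px Py s01 qE.
  have [] := V _ _ s (bipyr_base Px) (bipyr_base Py) s01.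
    by rewrite !height_scale height_add qE t0 normr0 subr0 scale1r !mulr0 addr0.
  rewrite t0 normr0 subr0 scale1r.
  by move=> /height_inj[-> _] /height_inj[-> _].
right; have [t1|t1] := eqVneq `|t| 1.
  by exists t => //; rewrite t1 subrr scale0r.
have Bs : bipyr P (row_mx 0 (Num.sg t)%:M).
  by apply: bipyr_apex; rewrite normr_sg lern1 leq_b1.
have tpos : 0 < `|t| by rewrite normr_gt0.
have t_lt1 : `|t| < 1 by rewrite lt_neqAle t1; lra.
have [||_ /height_inj[_ ts]] := V _ _ (1 - `|t|) (bipyr_base Pq) Bs.
- by rewrite subr_gt0 t_lt1 gtrBl.
- rewrite !height_scale height_add scaler0 addr0 mulr0 add0r subKr.
  by rewrite [`|_| * _]mulrC -numEsg.
- by move: t1; rewrite -ts normr_sg t0 eqxx.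
Qed.

Lemma bipyr_lattice_polytope :
  lattice_polytope P -> lattice_polytope (bipyr P).
Proof.
move=> [polyP vertP]; split; first exact: bipyr_polytope.
move=> v /bipyr_vertex[[p /vertP Lp ->]|[t t1 ->]]; apply/lattice_pt_row_mx.
  by split.
split; first by apply/mxOverP => i j; rewrite mxE.
move/eqP: t1; rewrite eqr_norml => /andP[/orP[]/eqP-> _];
  by rewrite ?rpredN rpred1.
Qed.

(** The height is an integer of absolute value at most 1, and [|t| = 1] leaves no weight for the
    base. *)
Lemma bipyr_lattice_pt a t : bipyr P (row_mx a t%:M) ->
  lattice_pt (row_mx a t%:M : 'rV_(d + 1)) ->
  [\/ P a /\ t = 0, a = 0 /\ t = 1 | a = 0 /\ t = - 1].
Proof.
move=> /bipyrP[p [alpha [Pp alpha0 alphat ->]]] /lattice_pt_row_mx[_ Lt].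
have [t0|/(norm_intr_ge1 Lt) t1] := eqVneq t 0.
  apply: Or31; split=> //; rewrite t0 normr0 addr0 in alphat.
  by have [q Pq ->] := convex_scale cP P0 Pp alpha0 alphat; rewrite scale1r.
have -> : alpha = 0 by lra.
rewrite scale0r; have /eqP : `|t| = 1 by lra.
by rewrite eqr_norml => /andP[/orP[]/eqP -> _]; [exact: Or32|exact: Or33].
Qed.

(** * Transfer of decompositions between [P] and its bipyramid *)

Lemma normal_bipyr : normal_polytope P -> normal_polytope (bipyr P).
Proof.
move=> [latP normP]; split; first exact: bipyr_lattice_polytope.
move=> N _ v [w Bw <-]; have [a [t wE]] := height_split w.
move: Bw; rewrite {}wE height_scale.
move=> /bipyrP[p [alpha [Pp alpha0 alphat ->]]] /lattice_pt_row_mx[La Lt].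
have /natrP[m mE] : `|N%:R * t| \is a Num.nat by rewrite natr_norm_int.
have mN : N%:R * (alpha + `|t|) <= N%:R by rewrite ler_piMr.
have {}mN : N%:R * alpha <= N%:R - m%:R :> R.
  by rewrite -mE normrM ger0_norm // lerBrDr -mulrDr.
have le_mN : (m <= N)%N.
  by rewrite -(ler_nat R); have := mulr_ge0 (ler0n R N) alpha0; lra.
rewrite -natrB // in mN; rewrite scalerA in La *.
have [q Pq qE] := convex_scale cP P0 Pp (mulr_ge0 (ler0n R N) alpha0) mN.
rewrite qE in La *.
have [f [fP ->]] : lattice_sum P (N - m) ((N - m)%:R *: q).
  (* Normality speaks of positive dilations only; for [N - m = 0] the base point is 0, the empty
     sum. *)
  case: (posnP (N - m)) => [->|k0]; first by rewrite scale0r; exact: lattice_sum0.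
  by apply: normP => //; exists q.
(* At height 0 this [s] is 0 and gives no apex, but then [m = 0] and no copy is taken, so no case
   split on the sign is required. *)
pose s : R := Num.sg (N%:R * t).
have -> : row_mx (\sum_i f i) (N%:R * t)%:M = row_mx 0 s%:M *+ m +
    \sum_i row_mx (f i) 0%:M :> 'rV[R]_(d + 1).
  have -> : \sum_i row_mx (f i) 0%:M =
      row_mx (\sum_i f i) 0%:M :> 'rV[R]_(d + 1).
    apply: (big_ind2 (fun x y => y = row_mx x 0%:M)) => //.
    - by rewrite raddf0 row_mx0.
    - by move=> x _ y _ -> ->; rewrite height_add addr0.
  rewrite -scaler_nat height_scale height_add scaler0 add0r addr0 -mE.
  by rewrite [`|_| * _]mulrC -numEsg.
have s1 : `|s| <= 1 by rewrite normr_sg lern1 leq_b1.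
have Ls : lattice_pt (row_mx 0 s%:M : 'rV[R]_(d + 1)).
  apply/lattice_pt_row_mx; split; first by apply/mxOverP => i j; rewrite mxE.
  by rewrite /s; case: sgrP => _; rewrite ?rpredN ?rpred0 ?rpred1.
have Sf : lattice_sum (bipyr P) (N - m) (\sum_i row_mx (f i) 0%:M).
  exists (fun i => row_mx (f i) 0%:M); split=> // i; have [Pfi Lfi] := fP i.
  by split; [exact: bipyr_base|exact/lattice_pt_row_mx].
have := lattice_sum_padding m (bipyr_apex s1) Ls Sf.
by rewrite (subnKC le_mN).
Qed.

(** Here [k], [kp] and [km] count the summands at height 0, at the upper apex and at the lower
    apex. *)
Lemma lattice_sum_bipyr M a t : lattice_sum (bipyr P) M (row_mx a t%:M) ->
  exists k kp km,
    [/\ M = (k + kp + km)%N, t = kp%:R - km%:R & lattice_sum P k a].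
Proof.
elim: M a t => [|M IHM] a t.
  move=> [f []]; rewrite big_ord0 => _.
  rewrite -(row_mx0 _ _ d) -(raddf0 scalar_mx).
  move=> /height_inj[-> ->]; exists 0, 0, 0; rewrite subrr.
  by split=> //; exact: lattice_sum0.
move=> /lattice_sumS_inv[c [b [Bc Lc Sb]]].
have [c' [s cE]] := height_split c; have [b' [u bE]] := height_split b.
rewrite {}cE in Bc Lc *; rewrite {}bE in Sb *.
rewrite height_add => /height_inj[-> ->].
have [k [kp [km [-> -> Sk]]]] := IHM _ _ Sb.
case: (bipyr_lattice_pt Bc Lc) => [[Pc' s0]|[-> ->]|[-> ->]].
- exists k.+1, kp, km; rewrite s0 add0r !addSn; split=> //.
  by apply: lattice_sumS => //; case/lattice_pt_row_mx: Lc.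
- by exists k, kp.+1, km; rewrite add0r addnS addSn mulrSr; split=> //; ring.
- by exists k, kp, km.+1; rewrite add0r addnS mulrSr; split=> //; ring.
Qed.

Lemma very_ample_bipyr_decomposable N :
  very_ample (bipyr P) -> decomposable_at P N.
Proof.
move=> [_ [N0 ampl]] _ [p Pp <-] La.
(* Lifting to height [N0] makes the dilation factor [N + N0] large enough for very ampleness,
   whatever [N] is. *)
have Np : dilate (N + N0) (bipyr P) (row_mx (N%:R *: p) N0%:R%:M).
  have [n0|n0] := posnP (N + N0)%N.
    move/eqP: n0; rewrite addn_eq0 => /andP[/eqP-> /eqP->].
    exists (row_mx 0 0%:M); first exact: bipyr_base.
    by rewrite height_scale !scale0r mul0r.
  have nz : (N + N0)%:R != 0 :> R by rewrite pnatr_eq0 -lt0n.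
  exists ((N + N0)%:R^-1 *: row_mx (N%:R *: p) N0%:R%:M).
    rewrite height_scale scalerA; apply/bipyrP.
    exists p, ((N + N0)%:R^-1 * N%:R); split=> //.
    by rewrite normrM !ger0_norm // -mulrDr -natrD mulVf.
  by rewrite scalerA mulfV // scale1r.
have := ampl _ (leq_addl N N0) _ Np; case=> [|f fP].
  by apply/lattice_pt_row_mx.
have [k [kp [km [NE N0E Sk]]]] :
    exists k kp km, [/\ (N + N0 = k + kp + km)%N, N0%:R = kp%:R - km%:R :> R
                      & lattice_sum P k (N%:R *: p)].
  by apply: lattice_sum_bipyr; exists f.
have {}N0E : (N0 + km)%N = kp.
  by apply/eqP; rewrite -(eqr_nat R) natrD N0E subrK.
have L0 : lattice_pt (0 : 'rV[R]_d) by apply/mxOverP => i j; rewrite mxE.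
(* Comparing heights gave [kp = N0 + km], so counting summands gives [N = k + 2 km]; zeros fill the
   [2 km] missing places. *)
have := lattice_sum_padding (km + km) P0 L0 Sk; rewrite mul0rn add0r.
by have -> : (km + km + k)%N = N by lia.
Qed.

End Bipyramid.

Theorem proposition3p2 (R : realType) (d : nat) (P : set 'rV[R]_d)
    (reflP : reflexive_polytope P) :
  [<-> normal_polytope P; normal_polytope (bipyr P); very_ample (bipyr P)].
Proof.
have [latP _ /interior_subset P0 _] := reflP.
have cP : @convex_set R _ P.
  by have [[A [_ ->]] _] := latP; exact: convex_conv_hull.
tfae.
- exact: normal_bipyr.
- by move=> [latB normB]; split=> //; exists 1%N.
- by move=> amplB; split=> // N _; exact: very_ample_bipyr_decomposable.
Qed.
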